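(* Let $\mathcal F\subset(\Sigma_T\times\Sigma_T)^*$ be the caret-type language of Thompson's group $F$, where $\Sigma_T=\{e,r,(,),a,b\}$. Then $\mathcal F$ is not a context-free language.
   Context: Thompson's group. $F$ is the group of piecewise linear homeomorphisms of $[0,1]$ (orientation preserving) with finitely many linear pieces, breakpoints with dyadic rational coordinates, and slopes powers of $2$. A finite rooted binary tree (with at least one caret) has carets: a caret is a non-leaf vertex together with its left and right downward edges. A caret $D$ is the left (right) child of caret $C$ if the vertex of $D$ is the endpoint of the left (right) edge of $C$. The tree determines a dyadic subdivision of $[0,1]$: the root corresponds to $[0,1]$, the two edges of a caret bisect its interval, and the leaves, from left to right, give the subintervals. A pair $(T,S)$ of such trees with the same number of carets represents the element of $F$ mapping the $i$-th leaf interval of $T$ affinely onto the $i$-th leaf interval of $S$ for all $i$. Carets of a tree are numbered in infix order (left subtree, then the caret, then right subtree). A caret is exposed if it has no children. The pair $(T,S)$ is reduced if no caret number $n$ is such that caret $n$ is exposed in both $T$ and $S$, except that the pair of single-caret trees is regarded as the reduced pair for the identity; each element of $F$ has a unique reduced pair. Caret types. A caret is exterior if at least one of its edges lies on the left or right side of the tree (this includes the root), and interior otherwise. The root caret has type $r$; every other exterior caret has type $e$. Call an interior caret ''of the first kind'' if it is the left child of an interior caret or a child of an exterior caret, and ''of the second kind'' otherwise. An interior caret of the first kind has type $($ if it has a right child and $a$ if it has none; an interior caret of the second kind has type $b$ if it has a right child and $)$ if it has none. The word of a tree is the list of its caret types in infix order, a word over $\Sigma_T$. For $g\in F$ with reduced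 pair $(T,S)$, $\nu(g)\in(\Sigma_T\times\Sigma_T)^*$ is the word whose $i$-th letter is $\binom{t_i}{s_i}$, where $t_i,s_i$ are the $i$-th letters of the words of $T$ and $S$. The caret-type language is $\mathcal F=\{\nu(g)\mid g\in F\}$. *)

(* Defs.v *)
From HB Require Import structures.
From Stdlib Require Import Relation_Operators.
From mathcomp Require Import all_boot all_order all_algebra.
From mathcomp Require Import boolp classical_sets set_interval reals.
From mathcomp Require Import topology normedtype.

Set Implicit Arguments.
Unset Strict Implicit.
Unset Printing Implicit Defensive.

Import Order.TTheory GRing.Theory Num.Theory.
Import numFieldNormedType.Exports.

Local Open Scope classical_set_scope.
Local Open Scope ring_scope.

Record cfg (A : finType) := Cfg {
  cfg_nonterminal : finType;
  cfg_start : cfg_nonterminal;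
  cfg_rules : seq (cfg_nonterminal * seq (cfg_nonterminal + A))
}.

Definition cfg_step (A : finType) (G : cfg A)
    (u v : seq (cfg_nonterminal G + A)) : Prop :=
  exists l r X rhs, [/\ (X, rhs) \in cfg_rules G,
    u = l ++ inl X :: r & v = l ++ rhs ++ r].

Definition cfg_language (A : finType) (G : cfg A) : set (seq A) :=
  [set w | clos_refl_trans _ (@cfg_step A G)
             [:: inl (cfg_start G)] [seq inr x | x <- w]].

Definition context_free (A : finType) (L : set (seq A)) : Prop :=
  exists G : cfg A, cfg_language G = L.

Inductive tree := Leaf | Node of tree & tree.

(* Vertices are addressed by the path from the root: [false] follows a left
   edge and [true] a right edge.  A caret is identified with its (non-leaf)
   vertex, an edge with its lower endpoint. *)
Definition address := seq bool.

Fixpoint carets (T : tree) : seq address :=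
  if T is Node l r then
    [seq false :: p | p <- carets l] ++ [::] :: [seq true :: p | p <- carets r]
  else [::].

Fixpoint leaves (T : tree) : seq address :=
  if T is Node l r then
    [seq false :: p | p <- leaves l] ++ [seq true :: p | p <- leaves r]
  else [:: [::]].

Definition num_carets (T : tree) : nat := size (carets T).

Definition has_child (T : tree) (p : address) (d : bool) : bool :=
  rcons p d \in carets T.

Definition exposed (T : tree) (p : address) : bool :=
  ~~ has_child T p false && ~~ has_child T p true.

Definition on_left_side (p : address) : bool := all (pred1 false) p.
Definition on_right_side (p : address) : bool := all (pred1 true) p.

Definition exterior (p : address) : bool :=
  [|| on_left_side (rcons p false), on_right_side (rcons p false),
      on_left_side (rcons p true) | on_right_side (rcons p true)].

Definition parent (p : address) : address := take (size p).-1 p.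

(* Meaningful for interior carets only; these are never the root, so the last
   letter of the address tells whether [p] is a left or a right child. *)
Definition first_kind (p : address) : bool :=
  exterior (parent p) || ~~ last true p.

Inductive caret_type := Te | Tr | Topen | Tclose | Ta | Tb.

Definition caret_type_ord (c : caret_type) : 'I_6 :=
  match c with
  | Te => @Ordinal 6 0 isT | Tr => @Ordinal 6 1 isT
  | Topen => @Ordinal 6 2 isT | Tclose => @Ordinal 6 3 isT
  | Ta => @Ordinal 6 4 isT | Tb => @Ordinal 6 5 isT
  end.

Definition ord_caret_type (i : 'I_6) : caret_type :=
  nth Te [:: Te; Tr; Topen; Tclose; Ta; Tb] i.

Lemma caret_type_ordK : cancel caret_type_ord ord_caret_type.
Proof. by case. Qed.

HB.instance Definition _ := Finite.copy caret_type (can_type caret_type_ordK).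

Definition type_of_caret (T : tree) (p : address) : caret_type :=
  if p == [::] then Tr
  else if exterior p then Te
  else if first_kind p then (if has_child T p true then Topen else Ta)
  else (if has_child T p true then Tb else Tclose).

Definition tree_word (T : tree) : seq caret_type :=
  [seq type_of_caret T p | p <- carets T].

Definition one_caret : tree := Node Leaf Leaf.

Definition tree_pair (T S : tree) : Prop :=
  (0 < num_carets T)%N /\ num_carets T = num_carets S.

Definition reduced (T S : tree) : Prop :=
  (T = one_caret /\ S = one_caret) \/
  ~ (exists2 n, (n < num_carets T)%N &
       exposed T (nth [::] (carets T) n) /\ exposed S (nth [::] (carets S) n)).

Section ThompsonGroup.
Variable R : realType.

(* The left endpoint and the length of the dyadic interval at a vertex. *)
Fixpoint interval_left (p : address) : R :=
  if p is d :: q then (d%:R + interval_left q) / 2 else 0.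
Definition interval_length (p : address) : R := 2 ^- size p.
Definition interval_right (p : address) : R :=
  interval_left p + interval_length p.

Definition dyadic (x : R) : Prop :=
  exists (m : int) (n : nat), x = m%:~R / 2 ^+ n.

Definition homeomorphism01 (g : R -> R) : Prop :=
  [/\ forall x, x \in `[0, 1] -> g x \in `[0, 1],
      {within `[0, 1], continuous g} &
      exists h : R -> R,
        [/\ forall x, x \in `[0, 1] -> h x \in `[0, 1],
            {within `[0, 1], continuous h},
            {in `[0, 1], cancel g h} & {in `[0, 1], cancel h g}]].

(* The points [0 :: s] subdivide [0, 1]. *)
Definition dyadic_piecewise_linear (g : R -> R) : Prop :=
  exists s : seq R,
    [/\ path <%R 0 s, last 0 s = 1,
        forall x, x \in s -> dyadic x &
        forall i, (i < size s)%N ->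
          exists (k : int) (c : R), forall x,
            x \in `[nth 0 (0 :: s) i, nth 0 s i] -> g x = 2 ^ k * x + c].

(* An element of F is represented by a function R -> R of which only the
   restriction to [0, 1] matters. *)
Definition thompsonF : set (R -> R) :=
  [set g | [/\ homeomorphism01 g,
               {in `[0, 1] &, {homo g : x y / x < y}} &
               dyadic_piecewise_linear g]].

Definition represents (T S : tree) (g : R -> R) : Prop :=
  forall i, (i < size (leaves T))%N ->
    let p := nth [::] (leaves T) i in
    let q := nth [::] (leaves S) i in
    forall x, x \in `[interval_left p, interval_right p] ->
      g x = interval_left q
            + interval_length q / interval_length p * (x - interval_left p).

(* Each element of F has exactly one reduced pair, so this relation is the
   graph of the map nu. *)
Definition is_nu (g : R -> R) (w : seq (caret_type * caret_type)) : Prop :=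
  exists T S, [/\ tree_pair T S, reduced T S, represents T S g &
                  w = zip (tree_word T) (tree_word S)].

Definition caret_type_language : set (seq (caret_type * caret_type)%type) :=
  [set w | exists2 g, thompsonF g & is_nu g w].

End ThompsonGroup.

(* Main.v *)
(* Each component of a word of the language comes from a tree, so in each
   component "(" and ")" are equinumerous, r occurs once and, if there are two
   carets, e occurs.  Two crossing nestings, with
   A = ((, a), B = (a, (), C = (), a) and D = (a, )), give reduced words
   (r, r) A^m B^m C^m D^m (e, e).  Deleting the two pumped factors must delete
   as many letters A as C and as many B as D, which a window of length m does
   not allow, and it can delete neither (r, r) nor (e, e). *)
From Stdlib Require Import Relation_Operators Operators_Properties.
Require Import Defs.
From mathcomp Require Import all_boot all_order all_algebra.
From mathcomp Require Import classical_sets set_interval reals.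
From mathcomp Require Import topology normedtype realfun.
From mathcomp Require Import ring zify.

Set Implicit Arguments.
Unset Strict Implicit.
Unset Printing Implicit Defensive.

Import Order.TTheory GRing.Theory Num.Theory.
Import numFieldNormedType.Exports.

(** * The pumping lemma *)

Section Pumping.
Variables (A : finType) (G : cfg A).
Implicit Types (X Y : cfg_nonterminal G) (s r : seq (cfg_nonterminal G + A)).
Implicit Types (u v w x y z : seq A) (S : {set cfg_nonterminal G}).

Let tm w : seq (cfg_nonterminal G + A) := [seq inr a | a <- w].
Let derives := clos_refl_trans _ (@cfg_step A G).

Lemma derives_context l r s1 s2 :
  derives s1 s2 -> derives (l ++ s1 ++ r) (l ++ s2 ++ r).
Proof.
elim=> [_ _ [l0 [r0 [X [rhs [Xrhs -> ->]]]]]| |? s' ? _ + _]; last 2 first.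
- by move=> ?; exact: rt_refl.
- exact: rt_trans.
apply: rt_step; exists (l ++ l0), (r0 ++ r), X, rhs.
by split; rewrite // -!catA.
Qed.

Lemma derives_rule X rhs :
  (X, rhs) \in cfg_rules G -> derives [:: inl X] rhs.
Proof.
by move=> Xrhs; apply: rt_step; exists [::], [::], X, rhs; rewrite cats0.
Qed.

(* A derivation of [w] from [s] in whose parse forest no nonterminal is its own
   proper ancestor; [S] is the set of nonterminals already met above [s]. *)
Inductive nonrepeating S : seq (cfg_nonterminal G + A) -> seq A -> Prop :=
| nonrepeating_nil : nonrepeating S [::] [::]
| nonrepeating_terminal a s w :
    nonrepeating S s w -> nonrepeating S (inr a :: s) (a :: w)
| nonrepeating_nonterminal X rhs s w1 w2 :
    X \notin S -> (X, rhs) \in cfg_rules G -> nonrepeating (X |: S) rhs w1 ->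
    nonrepeating S s w2 -> nonrepeating S (inl X :: s) (w1 ++ w2).

Lemma nonrepeating_derives S s w : nonrepeating S s w -> derives s (tm w).
Proof.
elim=> {S s w} [S|S a s w _ IH|S X rhs s w1 w2 _ Xrhs _ IH1 _ IH2].
- exact: rt_refl.
- by have := derives_context [:: inr a] [::] IH; rewrite !cats0.
- rewrite /tm map_cat.
  apply: (@rt_trans _ _ _ (tm w1 ++ s)).
    apply: (derives_context [::] s (s1 := [:: inl X]) (s2 := tm w1)).
    by apply: rt_trans IH1; exact: derives_rule.
  by have := derives_context (tm w1) [::] IH2; rewrite !cats0.
Qed.

Lemma nonrepeating_weaken S' S s w :
  S' \subset S -> nonrepeating S s w -> nonrepeating S' s w.
Proof.
move=> + sw; elim: sw S' => {S s w}
  [S|S a s w _ IH|S X rhs s w1 w2 XS Xrhs _ IH1 _ IH2] S' sS.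
- exact: nonrepeating_nil.
- by apply: nonrepeating_terminal; exact: IH.
- apply: (nonrepeating_nonterminal _ Xrhs); last exact: IH2.
    by apply: contra XS => /(fintype.subsetP sS).
  by apply: IH1; exact: finset.setUS.
Qed.

Lemma nonrepeating_cat S s1 s2 w1 w2 :
  nonrepeating S s1 w1 -> nonrepeating S s2 w2 ->
  nonrepeating S (s1 ++ s2) (w1 ++ w2).
Proof.
elim=> {S s1 w1} [//|S a s w _ IH|S X rhs s w w' XS Xrhs Sw _ _ IH] sw2 /=.
  by apply: nonrepeating_terminal; exact: IH.
by rewrite -catA; apply: (nonrepeating_nonterminal XS Xrhs Sw); exact: IH.
Qed.

Lemma nonrepeating_catE S s1 s2 w : nonrepeating S (s1 ++ s2) w ->
  exists w1 w2,
    [/\ w = w1 ++ w2, nonrepeating S s1 w1 & nonrepeating S s2 w2].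
Proof.
elim: s1 w => [|t s1 IH] w /=.
  by move=> sw; exists [::], w; split=> //; exact: nonrepeating_nil.
move E : (t :: _) => s0 sw; case: sw E => // [a s w'|X rhs s w1 w2].
  move=> sw [-> E]; rewrite -E in sw; have [w1 [w2 [-> sw1 sw2]]] := IH _ sw.
  by exists (a :: w1), w2; split=> //; exact: nonrepeating_terminal.
move=> XS Xrhs Sw sw [-> E]; rewrite -E in sw.
have [w3 [w4 [-> sw3 sw4]]] := IH _ sw.
by exists (w1 ++ w3), w4; split; rewrite ?catA //;
  exact: nonrepeating_nonterminal Sw sw3.
Qed.

(** Every expansion adds its nonterminal to [S], so the trees have height at most the number of
    nonterminals outside [S], while each vertex has at most [b] children. *)
Lemma nonrepeating_size b S s w :
  (0 < b)%N -> (forall R, R \in cfg_rules G -> size R.2 <= b)%N ->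
  nonrepeating S s w -> (size w <= size s * b ^ #|~: S|)%N.
Proof.
move=> b0 hb.
elim=> {S s w} [//|S a s w _ IH|S X rhs s w1 w2 XS Xrhs _ IH1 _ IH2] /=.
  by rewrite mulSn -add1n leq_add // expn_gt0 b0.
rewrite size_cat mulSn leq_add // (leq_trans IH1) //.
have -> : #|~: S| = #|~: (X |: S)|.+1.
  by rewrite finset.setCU finset.setIC -finset.setDE (cardsD1 X (~: S)) inE XS.
by rewrite expnS leq_mul2r (hb _ Xrhs) orbT.
Qed.

(** If [X] labels no vertex of the forest, it can be forbidden as well. Otherwise the subtree at an
    occurrence of [X] yields [w'], and cutting it off leaves a derivation of [X] between the
    terminal words [v] and [x]. *)
Lemma nonrepeating_avoid X S s w : nonrepeating S s w ->
  nonrepeating (X |: S) s w \/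
  exists v w' x, [/\ w = v ++ w' ++ x, nonrepeating S [:: inl X] w' &
    derives s (tm v ++ inl X :: tm x)].
Proof.
elim=> {s w S} [S|S a s w _ IH|S Y rhs s w1 w2 YS Yrhs sw1 IH1 sw2 IH2].
- by left; exact: nonrepeating_nil.
- case: IH => [sw|[v [w' [x [-> Xw' dsw]]]]].
    by left; exact: nonrepeating_terminal.
  right; exists (a :: v), w', x; split=> //.
  by have := derives_context [:: inr a] [::] dsw; rewrite !cats0.
have ds : derives s (tm w2) := nonrepeating_derives sw2.
have [YX|YX] := eqVneq Y X.
  right; exists [::], w1, w2; split=> //=.
    rewrite -(cats0 w1); apply: (nonrepeating_nonterminal (rhs := rhs)).
    - by rewrite -YX.
    - by rewrite -YX.
    - by rewrite -YX.
    - exact: nonrepeating_nil.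
  by have := derives_context [:: inl X] [::] ds; rewrite !cats0 YX.
case: IH1 => [sw1'|[v [w' [x [-> Xw' dsw]]]]].
  case: IH2 => [sw2'|[v [w' [x [-> Xw' dsw]]]]].
    left; apply: (nonrepeating_nonterminal _ Yrhs _ sw2').
      by rewrite !inE negb_or YX.
    by rewrite finset.setUCA.
  right; exists (w1 ++ v), w', x; split; rewrite -?catA //.
  rewrite /tm map_cat -catA.
  apply: (@rt_trans _ _ _ (tm w1 ++ s)).
    apply: (derives_context [::] s (s1 := [:: inl Y]) (s2 := tm w1)).
    by apply: rt_trans (derives_rule Yrhs) _; exact: nonrepeating_derives sw1.
  by have := derives_context (tm w1) [::] dsw; rewrite !cats0.
right; exists v, w', (x ++ w2); split; rewrite -?catA //.
  by apply: nonrepeating_weaken Xw'; exact: finset.subsetUr.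
rewrite /tm map_cat -[inl Y :: s]/([:: inl Y] ++ s).
apply: (@rt_trans _ _ _ ([:: inl Y] ++ tm w2)).
  by have := derives_context [:: inl Y] [::] ds; rewrite !cats0.
rewrite -cat_cons catA.
apply: (derives_context [::] (tm w2) (s1 := [:: inl Y])).
by apply: rt_trans (derives_rule Yrhs) dsw.
Qed.

(** The loop on [X] is stated for an arbitrary sentential form [s], so that it survives adding a
    step in front of the derivation. *)
Let pumpable p s z := exists X u v w x y,
  [/\ z = u ++ v ++ w ++ x ++ y, v ++ x <> [::], (size (v ++ w ++ x) <= p)%N &
   [/\ derives s (tm u ++ inl X :: tm y),
       derives [:: inl X] (tm v ++ inl X :: tm x)
     & derives [:: inl X] (tm w)]].

(** Induction on the derivation, peeling off its first step. When that step expands [X] to [rhs] and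
    the rest has a nonrepeating forest, [X] is put on top of the trees of [rhs]. This can only fail
    if [X] occurs below, and then the two occurrences of [X] form a loop. *)
Lemma derives_nonrepeating_or_pumpable b s z :
  (0 < b)%N -> (forall R, R \in cfg_rules G -> size R.2 <= b)%N ->
  derives s (tm z) ->
  nonrepeating finset.set0 s z \/ pumpable (b ^ #|cfg_nonterminal G|.+1) s z.
Proof.
move=> b0 hb /clos_rt_rt1n_iff; move E : (tm z) => s' d.
elim: d E => {s s'} [s <-|s s1 s' st _ IH /IH{IH}].
  left; elim: z => [|a z IH]; first exact: nonrepeating_nil.
  exact: nonrepeating_terminal.
case=> [|[X [u [v [w [x [y [-> vx hp [d1 d2 d3]]]]]]]]]; last first.
  right; exists X, u, v, w, x, y; split=> //; split=> //.
  by apply: rt_trans d1; exact: rt_step.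
case: st => l [r [X [rhs [Xrhs -> ->]]]].
case/nonrepeating_catE=> w1 [? [-> sw1]].
case/nonrepeating_catE=> w2 [w3 [-> sw2 sw3]].
have fits w' : nonrepeating finset.set0 [:: inl X] w' -> w' = w2 ->
    nonrepeating finset.set0 (l ++ inl X :: r) (w1 ++ w2 ++ w3).
  move=> + <- => Xw'; apply: nonrepeating_cat => //.
  by rewrite -[inl X :: r]/([:: inl X] ++ r); apply: nonrepeating_cat.
case: (nonrepeating_avoid X sw2) => [sw|[v [w [x [E Xw dsw]]]]].
  left; apply: fits erefl; rewrite -(cats0 w2).
  by apply: (nonrepeating_nonterminal _ Xrhs sw); rewrite ?inE //;
    exact: nonrepeating_nil.
(* An empty loop is cut out: the inner tree of [X] already yields all of [w2] and replaces the outer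
   one. *)
case vx : (v ++ x) => [|c t].
  left; apply: fits Xw _; rewrite E.
  by case: v x vx {E dsw} => // -[] //=; rewrite cats0.
right; exists X, w1, v, w, x, w3; split.
- by rewrite E -!catA.
- by rewrite vx.
(* The forest below [rhs] is nonrepeating and has at most [b] roots, which gives the extra factor
   [b] in the bound. *)
- rewrite -E (leq_trans (nonrepeating_size b0 hb sw2)) // finset.setC0 cardsT.
  by rewrite expnS leq_mul2r (hb _ Xrhs) orbT.
split; last exact: nonrepeating_derives Xw.
  apply: (@rt_trans _ _ _ (tm w1 ++ inl X :: r)).
    apply: (derives_context [::] (inl X :: r) (s1 := l)).
    exact: nonrepeating_derives sw1.
  have := derives_context (tm w1 ++ [:: inl X]) [::] (nonrepeating_derives sw3).
  by rewrite -!catA !cats0.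
by apply: rt_trans dsw; exact: derives_rule.
Qed.

(** A nonrepeating tree of the start symbol yields too short a word, so every longer word contains a
    loop. *)
Lemma cfg_language_pumping : exists p, forall z,
  cfg_language G z -> (p < size z)%N ->
  exists u v w x y,
    [/\ z = u ++ v ++ w ++ x ++ y, v ++ x <> [::], (size (v ++ w ++ x) <= p)%N &
     forall n, cfg_language G
       (u ++ flatten (nseq n v) ++ w ++ flatten (nseq n x) ++ y)].
Proof.
(* The successor keeps [b] positive even when all right-hand sides are empty. *)
pose b := (\max_(R <- cfg_rules G) size R.2).+1.
have hb R : R \in cfg_rules G -> (size R.2 <= b)%N.
  move=> RG; apply: leqW.
  by apply: (@leq_bigmax_seq _ _ predT (fun R => size R.2)) RG _.
exists (b ^ #|cfg_nonterminal G|.+1)%N => z Lz zp.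
have [sz|] := derives_nonrepeating_or_pumpable (ltn0Sn _) hb Lz.
  have := nonrepeating_size (ltn0Sn _) hb sz; rewrite -/b.
  rewrite finset.setC0 cardsT mul1n.
  by move=> /(leq_trans zp); rewrite ltnNge leq_pexp2l.
case=> X [u [v [w [x [y [-> vx hp [d1 d2 d3]]]]]]].
exists u, v, w, x, y; split=> // n; apply: rt_trans d1 _.
suff: derives [:: inl X] (tm (flatten (nseq n v) ++ w ++ flatten (nseq n x))).
  move=> /(derives_context (tm u) (tm y)); rewrite /tm !map_cat -!catA; exact.
elim: n => [|n IH]; first by rewrite cats0.
(* The outermost turn of the loop puts its [v] first and its [x] last. *)
have -> : flatten (nseq n.+1 x) = flatten (nseq n x) ++ x.
  by rewrite -addn1 nseqD flatten_cat /= cats0.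
apply: rt_trans d2 _; have := derives_context (tm v) (tm x) IH.
by rewrite /tm !map_cat -!catA.
Qed.

End Pumping.

(** * Words of trees *)

(** States of an automaton reading an address from the root. The position of a child depends only on
    that of its parent, which turns caret types into a recursion on trees. [LeftSide] and
    [RightSide] exclude the root. *)
Inductive caret_position :=
  Root | LeftSide | RightSide | FirstKind | SecondKind.

Definition child_position (c : caret_position) (d : bool) : caret_position :=
  match c, d with
  | Root, false | LeftSide, false => LeftSide
  | Root, true | RightSide, true => RightSide
  | LeftSide, true | RightSide, false | _, false => FirstKind
  | _, true => SecondKind
  end.

Definition caret_position_of : address -> caret_position :=
  foldl child_position Root.

Definition is_node (t : tree) : bool := if t is Node _ _ then true else false.

Definition letter (c : caret_position) (right_child : bool) : caret_type :=
  match c with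
  | Root => Tr
  | LeftSide | RightSide => Te
  | FirstKind => if right_child then Topen else Ta
  | SecondKind => if right_child then Tb else Tclose
  end.

(** The contribution of a subtree [t] whose root stands at position [c] in a larger tree. *)
Fixpoint word_at (c : caret_position) (t : tree) : seq caret_type :=
  if t is Node l r then
    word_at (child_position c false) l ++ letter c (is_node r) ::
    word_at (child_position c true) r
  else [::].

Lemma exteriorE p : exterior p = on_left_side p || on_right_side p.
Proof.
rewrite /exterior /on_left_side /on_right_side !all_rcons /=.
by do 2!case: (all _ p).
Qed.

Lemma caret_position_ofE p : caret_position_of p =
  if p == [::] then Root
  else if on_left_side p then LeftSide
  else if on_right_side p then RightSide
  else if first_kind p then FirstKind else SecondKind.
Proof.
elim/last_ind: p => [//|p d IH].
rewrite /caret_position_of foldl_rcons -/(caret_position_of p) {}IH.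
have -> : (rcons p d == [::]) = false by case: p.
rewrite /first_kind /parent size_rcons -cats1 take_size_cat //.
rewrite last_cat !exteriorE.
rewrite /on_left_side /on_right_side !all_cat /= !andbT.
case: p d => [|d' p] [] //; rewrite /= ?andbT ?andbF ?orbT ?orbF //;
  by case: d' => /=; case: (_ || ~~ _); case: (all _ p).
Qed.

Lemma type_of_caretE T p :
  type_of_caret T p = letter (caret_position_of p) (has_child T p true).
Proof.
rewrite /type_of_caret caret_position_ofE exteriorE.
by do !case: ifP => //=.
Qed.

Lemma mem_map_cons (d d' : bool) p (s : seq address) :
  (d :: p \in [seq d' :: q | q <- s]) = (d == d') && (p \in s).
Proof.
apply/mapP/andP => [[q qs [-> ->]]|[/eqP-> ps]]; first by rewrite eqxx.
by exists p.
Qed.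

Lemma mem_carets_cons l r d p :
  (d :: p \in carets (Node l r)) = (p \in carets (if d then r else l)).
Proof. by rewrite mem_cat inE !mem_map_cons /=; case: d; rewrite ?orbF. Qed.

Lemma nil_mem_carets t : ([::] \in carets t) = is_node t.
Proof. by case: t => //= l r; rewrite mem_cat inE orbT. Qed.

Lemma has_child_nil l r d :
  has_child (Node l r) [::] d = is_node (if d then r else l).
Proof. by rewrite /has_child mem_carets_cons nil_mem_carets. Qed.

Lemma has_child_cons l r d p d' :
  has_child (Node l r) (d :: p) d' = has_child (if d then r else l) p d'.
Proof. by rewrite /has_child rcons_cons mem_carets_cons. Qed.

Lemma tree_wordE T : tree_word T = word_at Root T.
Proof.
rewrite /tree_word (eq_map (type_of_caretE T)) /caret_position_of.
elim: T Root => [//|l IHl r IHr] c /=.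
rewrite map_cat /= -!map_comp has_child_nil -IHl -IHr.
by congr (_ ++ _ :: _); apply: eq_map => p /=; rewrite has_child_cons.
Qed.

Fixpoint exposed_at (t : tree) : seq bool :=
  if t is Node l r then
    exposed_at l ++ ~~ is_node l && ~~ is_node r :: exposed_at r
  else [::].

Lemma exposed_atE T : [seq exposed T p | p <- carets T] = exposed_at T.
Proof.
elim: T => [//|l IHl r IHr] /=; rewrite map_cat /= -!map_comp -IHl -IHr.
rewrite /exposed !has_child_nil.
by congr (_ ++ _ :: _); apply: eq_map => p /=; rewrite !has_child_cons.
Qed.

Lemma size_tree_word T : size (tree_word T) = num_carets T.
Proof. exact: size_map. Qed.

Definition second_kind (c : caret_position) : bool :=
  if c is SecondKind then true else false.

(* The interior second-kind carets below an opening caret form a right-going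
   path whose last element is closing and whose other elements have type b. *)
Lemma word_at_balanced c t :
  (count_mem Topen (word_at c t) + (second_kind c && is_node t) =
   count_mem Tclose (word_at c t))%N.
Proof.
elim: t c => [|l IHl r IHr] c; first by rewrite andbF.
rewrite /= !count_cat /= -IHl -IHr.
by case: c; case: (is_node r) => /=; lia.
Qed.

Lemma tree_word_balanced T :
  count_mem Topen (tree_word T) = count_mem Tclose (tree_word T).
Proof. by rewrite tree_wordE -word_at_balanced addn0. Qed.

Lemma count_root_tree_word T : (0 < num_carets T)%N ->
  count_mem Tr (tree_word T) = 1%N.
Proof.
(* [child_position] never returns [Root]. *)
have no_root c t : c <> Root -> count_mem Tr (word_at c t) = 0%N.
  elim: t c => [//|l IHl r IHr] c cR; rewrite /= count_cat /= IHl ?IHr.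
  - by case: c cR => //; case: (is_node r).
  - by case: c {cR}.
  - by case: c {cR}.
by case: T => // l r _; rewrite tree_wordE /= count_cat /= !no_root.
Qed.

(** A second caret forces the root to have a child, and any child of the root is exterior. *)
Lemma exterior_mem_tree_word T : (1 < num_carets T)%N -> Te \in tree_word T.
Proof.
rewrite -size_tree_word tree_wordE.
by case: T => [|[|??] [|??]] //= _; rewrite !(mem_cat, inE) !eqxx !orbT.
Qed.

(** * Crossing words *)

Lemma nseq_snoc (T : Type) n (x : T) : nseq n x ++ [:: x] = nseq n.+1 x.
Proof. by rewrite -addn1 nseqD. Qed.

(** At position [FirstKind] the left child is again of the first kind, so [append_a] adds a letter
    [Ta] at the end of the word. In [parenthesize] the right child is of the second kind and closes,
    so the word is enclosed between [Topen] and [Tclose]. *)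
Definition append_a (t : tree) : tree := Node t Leaf.
Definition parenthesize (t : tree) : tree := Node Leaf (Node t Leaf).

Lemma word_append_a n t : word_at FirstKind (iter n append_a t) =
  word_at FirstKind t ++ nseq n Ta.
Proof.
elim: n => [|n IH]; first by rewrite cats0.
by rewrite /= IH -catA nseq_snoc.
Qed.

Lemma word_parenthesize n t : word_at FirstKind (iter n parenthesize t) =
  nseq n Topen ++ word_at FirstKind t ++ nseq n Tclose.
Proof.
elim: n => [|n IH]; first by rewrite cats0.
by rewrite /= IH -!catA nseq_snoc.
Qed.

Lemma exposed_append_a n t : is_node t ->
  exposed_at (iter n append_a t) = exposed_at t ++ nseq n false.
Proof.
move=> nt; have nti k : is_node (iter k append_a t) by case: k.
elim: n => [|n IH]; first by rewrite cats0.
by rewrite /= IH nti -catA nseq_snoc.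
Qed.

Lemma exposed_parenthesize n t : is_node t ->
  exposed_at (iter n parenthesize t) =
  nseq n false ++ exposed_at t ++ nseq n false.
Proof.
move=> nt; have nti k : is_node (iter k parenthesize t) by case: k.
elim: n => [|n IH]; first by rewrite cats0.
by rewrite /= IH nti -!catA nseq_snoc.
Qed.

(** The shape of [parenthesize], but meant for the root of the whole tree: its two carets then have
    types [Tr] and [Te], and [t], as the child of an exterior caret, is of the first kind. *)
Definition hang (t : tree) : tree := Node Leaf (Node t Leaf).

Definition insert (t s : tree) : tree := Node t (Node s Leaf).

Lemma word_hang t :
  word_at Root (hang t) = Tr :: word_at FirstKind t ++ [:: Te].
Proof. by []. Qed.

Lemma word_insert t s : word_at FirstKind (insert t s) =
  word_at FirstKind t ++ Topen :: word_at FirstKind s ++ [:: Tclose].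
Proof. by []. Qed.

Lemma exposed_hang t : is_node t ->
  exposed_at (hang t) = false :: exposed_at t ++ [:: false].
Proof. by case: t. Qed.

Lemma exposed_insert t s : is_node s ->
  exposed_at (insert t s) =
  exposed_at t ++ false :: exposed_at s ++ [:: false].
Proof. by case: s => //= *; rewrite andbF. Qed.

(** With m = n + 1, these trees realize the two components of the crossing word. In [crossing_right]
    one of the m pairs of parentheses comes from [insert], hence only [n] iterations of
    [parenthesize]. *)
Definition crossing_left (n : nat) : tree :=
  hang (iter n.+1 append_a (iter n.+1 parenthesize (iter n.+1 append_a Leaf))).

Definition crossing_right (n : nat) : tree :=
  hang (insert (iter n.+1 append_a Leaf)
               (iter n parenthesize (iter n.+1 append_a Leaf))).

Lemma crossing_left_word n : tree_word (crossing_left n) =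
  Tr :: nseq n.+1 Topen ++ nseq n.+1 Ta ++ nseq n.+1 Tclose ++ nseq n.+1 Ta
  ++ [:: Te].
Proof.
rewrite tree_wordE word_hang word_append_a word_parenthesize word_append_a.
by rewrite -!catA.
Qed.

Lemma crossing_right_word n : tree_word (crossing_right n) =
  Tr :: nseq n.+1 Ta ++ nseq n.+1 Topen ++ nseq n.+1 Ta ++ nseq n.+1 Tclose
  ++ [:: Te].
Proof.
rewrite tree_wordE word_hang word_insert word_append_a word_parenthesize.
rewrite word_append_a -!catA.
by rewrite -[nseq n.+1 Tclose]nseq_snoc; do 2!rewrite /= -!catA.
Qed.

Lemma crossing_tree_pair n : tree_pair (crossing_left n) (crossing_right n).
Proof.
rewrite /tree_pair -!size_tree_word crossing_left_word crossing_right_word.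
by move: n.+1 => m; split; rewrite //= !size_cat !size_nseq.
Qed.

(** Only the first caret of an innermost comb is exposed. With m = n + 1 and carets counted from 0,
    this is caret m + 1 on the left and carets 1 and 2m + 1 on the right; these differ as m is
    positive. *)
Lemma crossing_reduced n : reduced (crossing_left n) (crossing_right n).
Proof.
right=> -[i]; have [_ sz] := crossing_tree_pair n => il [].
have ir : (i < num_carets (crossing_right n))%N by rewrite -sz.
rewrite -(nth_map _ false (exposed (crossing_left n)) il).
rewrite -(nth_map _ false (exposed (crossing_right n)) ir) !exposed_atE.
pose t := true :: nseq n false; pose f := nseq n.+1 false.
have comb : exposed_at (iter n.+1 append_a Leaf) = t.
  (* The innermost caret of the comb is taken as the base; all later ones have it or its ancestors
     as left child. *)
  by rewrite iterSr exposed_append_a.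
have -> : exposed_at (crossing_left n) =
    false :: (f ++ t ++ f ++ f) ++ [:: false].
  rewrite exposed_hang // exposed_append_a // exposed_parenthesize //.
  by rewrite comb -!catA.
have -> : exposed_at (crossing_right n) =
    false :: (t ++ f ++ t ++ f) ++ [:: false].
  rewrite exposed_hang // exposed_insert; last by case: n {t f comb il ir sz}.
  rewrite exposed_parenthesize // comb /f.
  rewrite -{2}(nseq_snoc n).
  by do 3!rewrite /= -!catA.
have nth_t k : nth false t k = (k == 0%N).
  by case: k => //= k; rewrite nth_nseq if_same.
have nth_f k : nth false f k = false by rewrite nth_nseq if_same.
have nth_1 k : nth false [:: false] k = false by case: k => [|[]].
have [sz_t sz_f] : size t = n.+1 /\ size f = n.+1 by rewrite /= !size_nseq.
(* From here only the sizes and entries of the blocks count, which leaves linear arithmetic on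
   indices. *)
clearbody t f; case: i {il ir} => //= i.
rewrite !nth_cat !nth_t !nth_f !nth_1 !size_cat sz_t sz_f.
by do !case: ifP => //; lia.
Qed.

Definition crossing_word (m : nat) : seq (caret_type * caret_type) :=
  (Tr, Tr) :: nseq m (Topen, Ta) ++ nseq m (Ta, Topen)
  ++ nseq m (Tclose, Ta) ++ nseq m (Ta, Tclose) ++ [:: (Te, Te)].

Lemma crossing_wordE n :
  zip (tree_word (crossing_left n)) (tree_word (crossing_right n)) =
  crossing_word n.+1.
Proof.
have zip_nseq k (x y : caret_type) :
    zip (nseq k x) (nseq k y) = nseq k (x, y).
  by elim: k => //= k ->.
rewrite crossing_left_word crossing_right_word; move: n.+1 => m.
by rewrite /= !zip_cat ?size_nseq // !zip_nseq.
Qed.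

(** * Letter counts and short factors of crossing words *)

Definition count_fst (c : caret_type) : seq (caret_type * caret_type) -> nat :=
  count (fun l => l.1 == c).
Definition count_snd (c : caret_type) : seq (caret_type * caret_type) -> nat :=
  count (fun l => l.2 == c).

Lemma count_fst_cat c s1 s2 :
  count_fst c (s1 ++ s2) = (count_fst c s1 + count_fst c s2)%N.
Proof. exact: count_cat. Qed.

Lemma count_snd_cat c s1 s2 :
  count_snd c (s1 ++ s2) = (count_snd c s1 + count_snd c s2)%N.
Proof. exact: count_cat. Qed.

Lemma count_fst_gt0 c l s : l \in s -> l.1 == c -> (0 < count_fst c s)%N.
Proof. by move=> ls lc; rewrite -has_count; apply/hasP; exists l. Qed.

Lemma count_snd_gt0 c l s : l \in s -> l.2 == c -> (0 < count_snd c s)%N.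
Proof. by move=> ls lc; rewrite -has_count; apply/hasP; exists l. Qed.

Lemma language_balanced (R : realType) w : caret_type_language R w ->
  count_fst Topen w = count_fst Tclose w /\
  count_snd Topen w = count_snd Tclose w /\
  count_fst Tr w = 1%N /\ (1 < size w -> 0 < count_fst Te w)%N.
Proof.
move=> [g _ [T [S [[T0 TS] _ _ ->]]]].
have sz : size (tree_word T) = size (tree_word S) by rewrite !size_tree_word.
have c1 c : count_fst c (zip (tree_word T) (tree_word S)) =
    count_mem c (tree_word T).
  rewrite -[in RHS](@unzip1_zip _ _ (tree_word T) (tree_word S)) ?sz //.
  by rewrite count_map.
have c2 c : count_snd c (zip (tree_word T) (tree_word S)) =
    count_mem c (tree_word S).
  rewrite -[in RHS](@unzip2_zip _ _ (tree_word T) (tree_word S)) ?sz //.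
  by rewrite count_map.
rewrite !c1 !c2 -!tree_word_balanced count_root_tree_word //; do 3!split=> //.
rewrite size_zip -sz minnn size_tree_word => /exterior_mem_tree_word.
by rewrite -has_pred1 has_count.
Qed.

(** Index 0 holds the root letter, and the four blocks start at 1, m + 1, 2m + 1 and 3m + 1. The
    default equals the last letter, so indices past the end are harmless. *)
Lemma crossing_word_nth m k : let l := nth (Te, Te) (crossing_word m) k in
  [/\ l.1 = Topen -> (k <= m)%N, l.1 = Tclose -> (2 * m < k)%N,
      l.2 = Topen -> (k <= 2 * m)%N & l.2 = Tclose -> (3 * m < k)%N].
Proof.
rewrite /crossing_word; case: k => [|k] //=.
rewrite !nth_cat !nth_nseq !size_nseq.
have -> : nth (Te, Te) [:: (Te, Te)] (k - m - m - m - m) = (Te, Te).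
  by case: (_ - m)%N => // -[].
by do !case: ifP => ? //; split=> //= _; lia.
Qed.

(** In each component a whole block of [m] letters [Ta] separates the opening letters from the
    closing ones. *)
Lemma crossing_word_window m u s y :
  crossing_word m = u ++ s ++ y -> (size s <= m)%N ->
  ~~ [&& 0 < count_fst Topen s & 0 < count_fst Tclose s]%N /\
  ~~ [&& 0 < count_snd Topen s & 0 < count_snd Tclose s]%N.
Proof.
move=> E sm.
have shift i : (i < size s)%N ->
    nth (Te, Te) s i = nth (Te, Te) (crossing_word m) (size u + i).
  by move=> si; rewrite E nth_cat ltnNge leq_addr /= addKn nth_cat si.
split; apply/negP; rewrite /count_fst /count_snd -!has_count => /andP[].
  move=> /(has_nthP (Te, Te))[i si /eqP]; rewrite shift // => hi.
  move=> /(has_nthP (Te, Te))[j sj /eqP]; rewrite shift // => hj.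
  have [+ _ _ _] := crossing_word_nth m (size u + i) => /(_ hi).
  by have [_ + _ _] := crossing_word_nth m (size u + j) => /(_ hj); lia.
move=> /(has_nthP (Te, Te))[i si /eqP]; rewrite shift // => hi.
move=> /(has_nthP (Te, Te))[j sj /eqP]; rewrite shift // => hj.
have [_ _ + _] := crossing_word_nth m (size u + i) => /(_ hi).
by have [_ _ _ +] := crossing_word_nth m (size u + j) => /(_ hj); lia.
Qed.

Lemma size_crossing_word m : size (crossing_word m) = (4 * m + 2)%N.
Proof. by rewrite /= !size_cat !size_nseq /=; lia. Qed.

Lemma count_exterior_crossing_word m : count_fst Te (crossing_word m) = 1%N.
Proof. by rewrite /count_fst /= !count_cat !count_nseq. Qed.

(** Each letter thus enters one of the counts controlled by [language_balanced], so none can be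
    deleted unnoticed. *)
Lemma crossing_word_mem m l : l \in crossing_word m ->
  [|| l.1 == Topen, l.1 == Tclose, l.2 == Topen, l.2 == Tclose, l.1 == Tr
    | l.1 == Te].
Proof.
rewrite inE !mem_cat !mem_nseq mem_seq1.
by do 5?[case/orP]; (move/eqP-> || case/andP=> _ /eqP->).
Qed.

(** * Piecewise linear interpolation *)

Section Interpolation.
Local Open Scope classical_set_scope.
Local Open Scope ring_scope.
Variable R : realType.
Implicit Types (s : seq (R * R)) (a b x y : R).

(* The graph starts at [(a, b)] and has the further vertices [s]; beyond the last
   vertex the value is constant. *)
Fixpoint interpolate s a b x : R :=
  if s is (a', b') :: s' then
    if x <= a' then b + (b' - b) / (a' - a) * (x - a)
    else interpolate s' a' b' x
  else b.

Definition increasing_graph s a b :=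
  path <%R a (unzip1 s) && path <%R b (unzip2 s).

Definition swap_graph s : seq (R * R) := [seq (v.2, v.1) | v <- s].

Lemma increasing_graph_swap s a b :
  increasing_graph (swap_graph s) b a = increasing_graph s a b.
Proof. by rewrite /increasing_graph andbC /unzip1 /unzip2 -!map_comp. Qed.

Lemma interpolate_start s a b :
  increasing_graph s a b -> interpolate s a b a = b.
Proof.
case: s => [//|[a' b'] s] /andP[/= /andP[aa' _] _].
by rewrite (ltW aa') subrr mulr0 addr0.
Qed.

(** At the shared vertex [x = a'] the test selects the earlier piece, but both pieces take the value
    [b'] there. *)
Lemma interpolate_tail s a b a' b' x :
  increasing_graph ((a', b') :: s) a b -> a' <= x ->
  interpolate ((a', b') :: s) a b x = interpolate s a' b' x.
Proof.
move=> /andP[/= /andP[aa' p1] /andP[bb' p2]] a'x; case: ifP => // xa'.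
have -> : x = a' by apply/le_anti; rewrite xa'.
rewrite interpolate_start; last by rewrite /increasing_graph p1.
by field; rewrite subr_eq0 gt_eqF.
Qed.

Lemma affine_le a a' b b' x : a < a' -> b < b' -> x <= a' ->
  b + (b' - b) / (a' - a) * (x - a) <= b'.
Proof.
move=> aa' bb' xa'; rewrite -lerBrDl -mulrA ler_piMr ?subr_ge0 ?(ltW bb') //.
by rewrite ler_pdivrMl ?subr_gt0 // mulr1 lerB.
Qed.

Lemma path_lt_le_nth (a : R) (s : seq R) i : path <%R a s -> (i <= size s)%N ->
  a <= nth 0 (a :: s) i.
Proof.
elim: s a i => [|a' s IH] a [|i] //= /andP[aa' p] si.
by apply: (le_trans (ltW aa')); exact: IH.
Qed.

Lemma path_lt_le_last (a : R) (s : seq R) : path <%R a s -> a <= last a s.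
Proof.
elim: s a => //= a' s IH a /andP[aa' p].
by apply: (le_trans (ltW aa')); exact: IH.
Qed.

Lemma interpolate_gt s a b x : increasing_graph s a b ->
  a < x <= last a (unzip1 s) -> b < interpolate s a b x.
Proof.
elim: s a b => [|[a' b'] s IH] a b.
  by move=> _ /andP[/lt_le_trans h /h]; rewrite ltxx.
move=> /andP[/= /andP[aa' p1] /andP[bb' p2]] /andP[ax xl].
case: (ltP a' x) => [a'x|xa'].
  by apply: (lt_trans bb'); apply: IH; rewrite /increasing_graph ?p1 ?a'x.
by rewrite ltrDl mulr_gt0 ?divr_gt0 ?subr_gt0.
Qed.

Lemma interpolate_le_last s a b x : increasing_graph s a b ->
  a <= x <= last a (unzip1 s) -> interpolate s a b x <= last b (unzip2 s).
Proof.
elim: s a b => [|[a' b'] s IH] a b //.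
move=> /andP[/= /andP[aa' p1] /andP[bb' p2]] /andP[ax xl].
have inc : increasing_graph s a' b' by rewrite /increasing_graph p1.
case: (ltP a' x) => [a'x|xa']; first by apply: IH => //; rewrite (ltW a'x).
by apply: (le_trans (affine_le aa' bb' xa')); exact: path_lt_le_last.
Qed.

Lemma interpolate_range s a b x : increasing_graph s a b ->
  x \in `[a, last a (unzip1 s)] ->
  interpolate s a b x \in `[b, last b (unzip2 s)].
Proof.
rewrite !in_itv /= => inc xal; rewrite interpolate_le_last // andbT.
case/andP: xal; rewrite le_eqVlt => /predU1P[<- _|ax xl].
  by rewrite interpolate_start.
by rewrite ltW // interpolate_gt // ax.
Qed.

(** Exchanging coordinates inverts each affine piece, and by monotonicity a value is at most [b']
    exactly when its argument is at most [a'], so both functions select the same piece. *)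
Lemma interpolateK s a b : increasing_graph s a b ->
  {in `[a, last a (unzip1 s)],
    cancel (interpolate s a b) (interpolate (swap_graph s) b a)}.
Proof.
move=> + x; rewrite in_itv /=; elim: s a b => [|[a' b'] s IH] a b.
  by move=> _ /le_anti.
move=> /andP[/= /andP[aa' p1] /andP[bb' p2]] /andP[ax xl].
have inc : increasing_graph s a' b' by rewrite /increasing_graph p1.
case: (ltP a' x) => [a'x|xa'].
  rewrite leNgt interpolate_gt ?a'x //=.
  by apply: IH; rewrite // (ltW a'x).
rewrite affine_le //; field.
by rewrite !subr_eq0 !gt_eqF.
Qed.

Lemma interpolate_lt s a b : increasing_graph s a b ->
  {in `[a, last a (unzip1 s)] &, {homo interpolate s a b : x y / x < y}}.
Proof.
move=> + x y; rewrite !in_itv /=; elim: s a b => [|[a' b'] s IH] a b.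
  by move=> _ /le_anti <- /le_anti <-; rewrite ltxx.
move=> /andP[/= /andP[aa' p1] /andP[bb' p2]] /andP[ax xl] /andP[ay yl] xy.
have inc : increasing_graph s a' b' by rewrite /increasing_graph p1.
case: (ltP a' y) => [a'y|ya'].
  case: (ltP a' x) => [a'x|xa'].
    by apply: IH; rewrite ?(ltW a'x) ?(ltW a'y).
  apply: (le_lt_trans (affine_le aa' bb' xa')).
  by rewrite interpolate_gt // a'y.
rewrite (le_trans (ltW xy) ya') ltrD2l ltr_pM2l ?ltrD2r //.
by rewrite divr_gt0 ?subr_gt0.
Qed.

Lemma interpolate_affine s a b i x : increasing_graph s a b ->
  (i < size s)%N ->
  let a0 := nth 0 (a :: unzip1 s) i in let a1 := nth 0 (unzip1 s) i in
  let b0 := nth 0 (b :: unzip2 s) i in let b1 := nth 0 (unzip2 s) i in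
  x \in `[a0, a1] ->
  interpolate s a b x = b0 + (b1 - b0) / (a1 - a0) * (x - a0).
Proof.
elim: s a b i => [//|[a' b'] s IH] a b [|i] inc si.
  by move=> a0 a1 b0 b1; rewrite in_itv /= => /andP[_ ->].
move=> a0 a1 b0 b1; rewrite in_itv => /andP[a0x xa1].
have [[aa' p1] [bb' p2]] :
    (a < a' /\ path <%R a' (unzip1 s)) /\ (b < b' /\ path <%R b' (unzip2 s)).
  by case/andP: inc => /andP[? ?] /andP[? ?].
rewrite interpolate_tail //; last first.
  apply: le_trans a0x; apply: path_lt_le_nth => //.
  by rewrite size_map ltnW.
apply: IH => //; first by rewrite /increasing_graph p1.
by rewrite in_itv; apply/andP.
Qed.

Lemma unzip1_swap s : unzip1 (swap_graph s) = unzip2 s.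
Proof. by rewrite /unzip1 -map_comp. Qed.

Lemma unzip2_swap s : unzip2 (swap_graph s) = unzip1 s.
Proof. by rewrite /unzip2 -map_comp. Qed.

Lemma swap_graphK : involutive swap_graph.
Proof.
move=> s; rewrite /swap_graph -map_comp -[RHS]map_id.
by apply: eq_map => -[].
Qed.

Lemma interpolateVK s a b : increasing_graph s a b ->
  {in `[b, last b (unzip2 s)],
    cancel (interpolate (swap_graph s) b a) (interpolate s a b)}.
Proof.
rewrite -increasing_graph_swap => /interpolateK.
by rewrite unzip1_swap swap_graphK.
Qed.

(** An increasing function that attains every value between those at the ends of a segment is
    continuous there; the swapped graph provides the preimages. *)
Lemma interpolate_continuous s a b : increasing_graph s a b ->
  {within `[a, last a (unzip1 s)], continuous (interpolate s a b)}.
Proof.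
move=> inc; have [p1 _] := andP inc.
apply: segment_inc_surj_continuous.
  exact: le_mono_in (interpolate_lt inc).
have range := interpolate_range inc.
move=> y /= ; rewrite in_itv /= => /andP[y1 y2].
have yin : y \in `[b, last b (unzip2 s)].
  have := range a; have := range (last a (unzip1 s)).
  rewrite !in_itv /= !lexx (path_lt_le_last p1) => /(_ isT)/andP[_ l2].
  by move=> /(_ isT)/andP[l1 _]; rewrite (le_trans l1) //= (le_trans y2).
exists (interpolate (swap_graph s) b a y); last exact: interpolateVK.
have := @interpolate_range (swap_graph s) b a y.
by rewrite increasing_graph_swap unzip1_swap unzip2_swap; exact.
Qed.

End Interpolation.

(** * Dyadic subdivisions and the element of F given by a tree pair *)

Section Endpoints.
Local Open Scope classical_set_scope.
Local Open Scope ring_scope.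
Variable R : realType.
Local Notation left := (interval_left R).
Local Notation right := (interval_right R).

Definition right_endpoints (T : tree) : seq R := [seq right p | p <- leaves T].

Lemma size_leaves T : size (leaves T) = (num_carets T).+1.
Proof.
rewrite /num_carets; elim: T => [//|l IHl r IHr] /=.
by rewrite !size_cat /= !size_map IHl IHr addSn addnS.
Qed.

Lemma interval_right_cons d p : right (d :: p) = (d%:R + right p) / 2.
Proof.
rewrite /interval_right /interval_length /= addrA [in RHS]mulrDl.
by rewrite exprSr invfM.
Qed.

Lemma interval_rightB p : right p - left p = interval_length R p.
Proof. by rewrite /interval_right addrAC subrr add0r. Qed.

(** Adjacent leaf intervals share an endpoint: the left endpoints are 0 followed by all right
    endpoints but the last. *)
Lemma leaves_endpoints T :
  [seq left p | p <- leaves T] = belast 0 (right_endpoints T) /\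
  last 0 (right_endpoints T) = 1.
Proof.
rewrite /right_endpoints.
elim: T => [|l [IHl El] r [IHr Er]].
  by rewrite /= /interval_right /interval_length /= expr0 invr1 add0r.
(* The affine map of the unit interval onto its left or right half, which carries the interval of
   [p] to that of [d :: p]. *)
pose half (d : bool) (x : R) : R := (d%:R + x) / 2.
have h00 : half false 0 = 0 by rewrite /half add0r mul0r.
have map_half (f : address -> R) d ps : (forall p, f (d :: p) = half d (f p)) ->
    [seq f q | q <- [seq d :: p | p <- ps]] =
    [seq half d x | x <- [seq f p | p <- ps]].
  by move=> fd; rewrite -!map_comp; apply: eq_map => p /=.
rewrite [leaves _]/= !map_cat !map_half;
  try by move=> p; rewrite ?interval_right_cons.
rewrite last_cat belast_cat -[X in belast X (map (half false) _)]h00.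
rewrite -[X in last X (map (half false) _)]h00 !last_map El.
(* The subdivisions of the two halves meet at the midpoint. *)
have -> : half false 1 = half true 0 by rewrite /half add0r addr0.
rewrite !last_map Er IHl IHr !belast_map; split=> //.
by rewrite /half -[true%:R]/(1 : R); field.
Qed.

Lemma endpoints_nth T i : (i < size (leaves T))%N ->
  nth 0 (0 :: right_endpoints T) i = left (nth [::] (leaves T) i) /\
  nth 0 (right_endpoints T) i = right (nth [::] (leaves T) i).
Proof.
move=> iT; split; last by rewrite (nth_map [::]).
have [E _] := leaves_endpoints T.
rewrite lastI nth_rcons size_belast size_map iT -E.
by rewrite (nth_map [::]).
Qed.

Lemma interval_length_gt0 p : 0 < interval_length R p.
Proof. by rewrite invr_gt0 exprn_gt0. Qed.

Lemma right_endpoints_path T : path <%R 0 (right_endpoints T).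
Proof.
apply/(pathP 0) => i; rewrite size_map => iT.
have [-> ->] := endpoints_nth iT.
by rewrite ltrDl interval_length_gt0.
Qed.

Lemma interval_right_dyadic p : dyadic (right p).
Proof.
have [m lp] : exists m : int, left p = m%:~R / 2 ^+ size p.
  elim: p => [|d p [m IH]]; first by exists 0; rewrite mul0r.
  (* The numerator is the address read in binary, most significant bit first. *)
  exists (d%:Z * 2 ^+ size p + m).
  rewrite /= IH exprS rmorphD rmorphM rmorphXn /=.
  rewrite -[(2%:~R : R)]/(2 : R) -pmulrn; field.
  by rewrite expf_neq0 ?pnatr_eq0.
exists (m + 1), (size p).
by rewrite /interval_right /interval_length lp rmorphD mulrDl mul1r.
Qed.

(** The element of F is the interpolation through the points that pair the right endpoints of
    corresponding leaves; the swapped graph gives its inverse. *)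
Lemma caret_type_language_reduced (T S : tree) :
  tree_pair T S -> reduced T S ->
  caret_type_language R (zip (tree_word T) (tree_word S)).
Proof.
move=> TS redTS.
have szTS : size (leaves T) = size (leaves S) by rewrite !size_leaves TS.2.
pose s := zip (right_endpoints T) (right_endpoints S).
have u1 : unzip1 s = right_endpoints T by rewrite unzip1_zip // !size_map szTS.
have u2 : unzip2 s = right_endpoints S by rewrite unzip2_zip // !size_map szTS.
have l1 : last 0 (unzip1 s) = 1 by rewrite u1; have [] := leaves_endpoints T.
have l2 : last 0 (unzip2 s) = 1 by rewrite u2; have [] := leaves_endpoints S.
have inc : increasing_graph s 0 0.
  by rewrite /increasing_graph u1 u2 !right_endpoints_path.
have inc' : increasing_graph (swap_graph s) 0 0.
  by rewrite increasing_graph_swap.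
have rep : represents T S (interpolate s 0 0).
  move=> i iT p q x xpq.
  have iS : (i < size (leaves S))%N by rewrite -szTS.
  have := @interpolate_affine _ s 0 0 i x inc.
  rewrite size_zip !size_map -szTS minnn u1 u2 => /(_ iT) /=.
  have [-> ->] := endpoints_nth iT; have [-> ->] := endpoints_nth iS.
  by rewrite !interval_rightB; exact.
exists (interpolate s 0 0); last by exists T, S.
split.
- split.
  + by move=> x; have := interpolate_range inc (x := x); rewrite l1 l2.
  + by have := interpolate_continuous inc; rewrite l1.
  exists (interpolate (swap_graph s) 0 0); split.
  + move=> x; have := interpolate_range inc' (x := x).
    by rewrite unzip1_swap unzip2_swap l1 l2.
  + by have := interpolate_continuous inc'; rewrite unzip1_swap l2.
  + by have := interpolateK inc; rewrite l1.
  + by have := interpolateVK inc; rewrite l2.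
- by have := interpolate_lt inc; rewrite l1.
exists (right_endpoints T); split.
- exact: right_endpoints_path.
- by have [] := leaves_endpoints T.
- by move=> x /mapP[p _ ->]; exact: interval_right_dyadic.
move=> i; rewrite size_map => iT; have := rep i iT.
set p := nth _ _ _; set q := nth _ _ _ => /= rpq.
(* The slope is the quotient of the lengths of the leaf intervals, a power of 2 whose exponent is
   the difference of depths. *)
exists ((size p)%:Z - (size q)%:Z).
exists (left q - interval_length R q / interval_length R p * left p) => x.
have [-> ->] := endpoints_nth iT => /rpq ->.
have -> : 2 ^ ((size p)%:Z - (size q)%:Z) =
    interval_length R q / interval_length R p.
  by rewrite expfzDr ?pnatr_eq0 // -exprnP -exprnN invrK mulrC.
by ring.
Qed.

End Endpoints.

(** * Pumping down a crossing word *)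

Theorem lemma4p5 (R : realType) : ~ context_free (caret_type_language R).
Proof.
case=> G LG; have [p pump] := cfg_language_pumping G.
have Lz : caret_type_language R (crossing_word p.+1).
  rewrite -crossing_wordE; apply: caret_type_language_reduced.
    exact: crossing_tree_pair.
  exact: crossing_reduced.
have szE := size_crossing_word p.+1.
have zp : (p < size (crossing_word p.+1))%N by rewrite szE; lia.
rewrite LG in pump; have {pump} := pump _ Lz zp.
(* Exponent 0 deletes [v] and [x]; it remains to show that both are empty. *)
case=> u [v [w [x [y [E vx /leqW sp /(_ 0%N) /= L0]]]]]; apply: vx.
have ce := count_exterior_crossing_word p.+1.
have [win1 win2] : let s := v ++ w ++ x in
  ~~ [&& 0 < count_fst Topen s & 0 < count_fst Tclose s]%N /\
  ~~ [&& 0 < count_snd Topen s & 0 < count_snd Tclose s]%N.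
  apply: (crossing_word_window (m := p.+1) (u := u) (y := y));
    by rewrite // E !catA.
have [c1 [c2 [cr _]]] := language_balanced Lz.
have {L0} [d1 [d2 [dr de]]] := language_balanced L0.
(* At most p + 1 of the 4(p + 1) + 2 letters are deleted, so at least two remain and an exterior
   letter must survive. *)
have {}de : (0 < count_fst Te (u ++ w ++ y))%N.
  apply: de; move: szE sp; rewrite E !size_cat.
  by move: (size u) (size v) (size w) (size x) (size y) => *; lia.
have vx_z l : l \in v ++ x -> l \in crossing_word p.+1.
  by rewrite E !mem_cat => /orP[] ->; rewrite ?orbT.
rewrite E in c1 c2 cr ce.
rewrite ?(count_fst_cat, count_snd_cat) in c1 c2 cr ce d1 d2 dr de win1 win2.
case vxE : (v ++ x) => [//|l t]; exfalso.
have lvx : l \in v ++ x by rewrite vxE mem_head.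
have pos1 c := @count_fst_gt0 c _ _ lvx.
have pos2 c := @count_snd_gt0 c _ _ lvx.
have := crossing_word_mem (vx_z _ lvx).
(* Balance before and after deletion gives [v ++ x] equally many opening and closing letters in each
   component, hence none by the window bound. The single [Tr] and the single [Te] both survive, so
   [l] has no possible type. *)
by do 5?[case/orP]; (move/pos1 || move/pos2);
  rewrite ?(count_fst_cat, count_snd_cat); lia.
Qed.
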